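(* Let $k$ be a field of characteristic $p>0$, let $d_1,\ldots,d_n$ be positive integers, let $A = k[x_1,\ldots,x_n]/(x_1^{d_1}, \ldots, x_n^{d_n})$ and $t = \sum_{i = 1}^n (d_i-1)$. If $\max(p,d_1, \ldots, d_n)>(t+1)/2$, then $A$ has the weak Lefschetz property.
   Context: $A$ is graded by degree, $A=\bigoplus_{i\ge0}A_i$. A graded artinian algebra $A$ has the weak Lefschetz property if there is a linear form $\ell\in A_1$ such that for every $i$ the map $A_i\to A_{i+1}$, $a\mapsto \ell a$, is injective or surjective. *)

(* Defs.v *)
From HB Require Import structures.
From mathcomp Require Import all_boot all_order all_algebra.
From mathcomp Require Import mpoly.
Set Implicit Arguments. Unset Strict Implicit. Unset Printing Implicit Defensive.
Import GRing.Theory.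
Local Open Scope ring_scope.

(* The monomial complete intersection A = k[x_1..x_n]/(x_1^{d_1},...,x_n^{d_n})
   is modelled by its standard normal form: the k-span of the monomials
   x^m with m_i < d_i for all i (the ideal is monomial, so these monomials
   form a k-basis of A, and the residue of a polynomial is obtained by
   discarding its non-standard monomials). *)

Section MCI.
Variables (k : fieldType) (n : nat) (d : 'I_n -> nat).

Definition std_mon (m : 'X_{1..n}) : bool := [forall i, (m i < d i)%N].

Definition mci_red (p : {mpoly k[n]}) : {mpoly k[n]} :=
  \sum_(m <- msupp p | std_mon m) p@_m *: 'X_[m].

Definition mci_piece (i : nat) (f : {mpoly k[n]}) : Prop :=
  forall m, m \in msupp f -> std_mon m /\ mdeg m = i.

Definition mci_mul (f g : {mpoly k[n]}) : {mpoly k[n]} := mci_red (f * g).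

Definition lin_form (c : 'I_n -> k) : {mpoly k[n]} := \sum_(j < n) c j *: 'X_j.

Definition mul_inj (l : {mpoly k[n]}) (i : nat) : Prop :=
  forall f, mci_piece i f -> mci_mul l f = 0 -> f = 0.

Definition mul_surj (l : {mpoly k[n]}) (i : nat) : Prop :=
  forall g, mci_piece i.+1 g -> exists2 f, mci_piece i f & mci_mul l f = g.

Definition mci_WLP : Prop :=
  exists c : 'I_n -> k,
    forall i : nat, mul_inj (lin_form c) i \/ mul_surj (lin_form c) i.

End MCI.

(* Main.v *)
Require Import Defs.
From HB Require Import structures.
From mathcomp Require Import all_boot all_order all_algebra.
From mathcomp Require Import mpoly.
From mathcomp Require Import ring zify.

(* Transposing multiplication by a linear form l and using x^m -> x^(d-1-m)
   turns surjectivity in degree i into injectivity in degree t-1-i, so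
   injectivity in all degrees i < t/2 suffices.  If some d_j > (t+1)/2, take
   l = x_j.  If p > (t+1)/2, take l to be the sum of the variables, E the
   multiplication by l, and F the lowering operator with FE - EF = t - 2i on
   A_i.  Since l v = 0 implies l (x_j v) = 0 and A has socle A_t, it is enough
   to treat the largest i < t/2.  There E v = 0 gives
   E F^(j+1) v = -(j+1)(t-2i+j) F^j v, so E^(i+1) kills the scalar F^i v.  As
   i+1 < p, the power l^(i+1) is nonzero in A, hence F^i v = 0, and the factors
   (j+1)(t-2i+j) being invertible, v = 0. *)

Set Implicit Arguments.
Unset Strict Implicit.
Unset Printing Implicit Defensive.

Import GRing.Theory.

(** The hypothesis makes the rows of the matrix [a], restricted to [P] and [Q], linearly
    independent; a matrix with free rows has a right inverse, which solves the system. *)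
Lemma transpose_surj (k : fieldType) (T : finType) (P Q : pred T) (a : T -> T -> k) :
  (forall f : T -> k, (forall y, Q y -> \sum_(x | P x) f x * a x y = 0)%R ->
     forall x, P x -> f x = 0%R) ->
  forall g : T -> k, exists h : T -> k,
    forall x, P x -> (\sum_(y | Q y) a x y * h y = g x)%R.
Proof.
move=> inj g.
pose A := (\matrix_(i < #|P|, j < #|Q|) a (enum_val i) (enum_val j))%R.
have freeA : row_free A.
  rewrite -kermx_eq0; apply/rowV0P => u /sub_kermxP uA0.
  (* Extends the row vector [u] by zero to a function on all of [T]. *)
  pose f x := (\sum_(i < #|P|) u 0 i * (enum_val i == x)%:R)%R.
  have fE i : (f (enum_val i) = u 0 i)%R.
    rewrite /f (bigD1 i) //= eqxx mulr1 big1 ?addr0 // => i' ne_i.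
    by rewrite (inj_eq enum_val_inj) (negPf ne_i) mulr0.
  apply/rowP => i; rewrite mxE -fE; apply: inj; last exact: enum_valP.
  move=> y Qy; have := congr1 (fun B : 'rV_ _ => B 0%R (enum_rank_in Qy y)) uA0.
  rewrite !mxE; apply: etrans.
  rewrite -[LHS]/(\sum_(x in P) f x * a x y)%R big_enum_val; apply: eq_bigr => i' _.
  by rewrite fE mxE enum_rankK_in.
pose w := (pinvmx A *m \col_i g (enum_val i))%R.
have Aw i : ((A *m w) i 0 = g (enum_val i))%R.
  by rewrite mulmxA mulmxVp ?mul1mx ?mxE.
exists (fun y => \sum_(j < #|Q|) w j 0 * (enum_val j == y)%:R)%R => x Px.
rewrite -(enum_rankK_in Px Px) -Aw mxE.
rewrite -[LHS]/(\sum_(y in Q) _)%R big_enum_val; apply: eq_bigr => j _.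
rewrite mxE (bigD1 j) //= eqxx mulr1 big1 ?addr0 // => j' ne_j.
by rewrite (inj_eq enum_val_inj) (negPf ne_j) mulr0.
Qed.

Section MonomialCompleteIntersection.

Local Open Scope ring_scope.

Variables (k : fieldType) (n : nat) (d : 'I_n -> nat).

Local Notation red := (mci_red d).
Local Notation piece := (mci_piece d).
Local Notation std := (std_mon d).
Implicit Types (f g v : {mpoly k[n]}) (m : 'X_{1..n}) (c : 'I_n -> k).

Let t := (\sum_(i < n) (d i - 1))%N.

(** * Coefficients of reductions and of products with linear forms *)

Lemma mcoeff_mci_red f m : (red f)@_m = if std m then f@_m else 0.
Proof.
rewrite /mci_red raddf_sum /=.
under eq_bigr do rewrite mcoeffZ mcoeffX.
case: ifP => [std_m|nstd_m]; last first.
  rewrite big1 // => m' std_m'; case: eqP => [eq_m|_]; last by rewrite mulr0.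
  by rewrite eq_m nstd_m in std_m'.
rewrite [in RHS](mpolyE f) raddf_sum /= big_mkcond /=; apply: eq_bigr => m' _.
rewrite mcoeffZ mcoeffX; case: ifP => // nstd_m'.
case: eqP => [eq_m|_]; last by rewrite mulr0.
by rewrite eq_m std_m in nstd_m'.
Qed.

Lemma mci_redZ a f : red (a *: f) = a *: red f.
Proof.
by apply/mpolyP => m; rewrite mcoeffZ !mcoeff_mci_red mcoeffZ; case: ifP; rewrite ?mulr0.
Qed.

Lemma mci_redB f g : red (f - g) = red f - red g.
Proof.
by apply/mpolyP => m; rewrite mcoeffB !mcoeff_mci_red mcoeffB; case: ifP; rewrite ?subr0.
Qed.

Lemma mci_pieceP i f :
  piece i f <-> forall m, ~~ (std m && (mdeg m == i)) -> f@_m = 0.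
Proof.
split=> [pf m|f0 m].
  by apply: contraNeq; rewrite -mcoeff_msupp => /pf[-> ->]; rewrite eqxx.
by rewrite mcoeff_msupp => /(contra_neqT (f0 m)) /andP[-> /eqP].
Qed.

Lemma mci_red_piece i f : piece i f -> red f = f.
Proof.
move=> /mci_pieceP f0; apply/mpolyP => m; rewrite mcoeff_mci_red.
by case: ifP => // nstd; rewrite f0 // nstd.
Qed.

Lemma mcoeff_mulX j f m :
  ('X_j * f)@_m = if (0 < m j)%N then f@_(m - U_(j)) else 0.
Proof.
rewrite -commr_mpolyX; case: ifP => [m_gt0|/negbT].
  have le_jm: (U_(j) <= m)%MM by rewrite lep1mP -lt0n.
  by rewrite -{1}(submK le_jm) addmC mcoeffMX.
rewrite -eqn0Ngt => mj0; apply: memN_msupp_eq0; apply/negP.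
rewrite (perm_mem (msuppMX _ _)) => /mapP[m' _] eq_m.
by move/eqP: mj0; rewrite eq_m mnmDE mnm1E eqxx.
Qed.

Lemma mcoeff_lin_form_mul c f m :
  (lin_form c * f)@_m = \sum_(j | (0 < m j)%N) c j * f@_(m - U_(j)).
Proof.
rewrite /lin_form mulr_suml raddf_sum /= [RHS]big_mkcond /=.
apply: eq_bigr => j _; rewrite -scalerAl mcoeffZ mcoeff_mulX.
by case: ifP; rewrite ?mulr0.
Qed.

Lemma std_mon_le m m' : (forall j, m' j <= m j)%N -> std m -> std m'.
Proof.
move=> le_m /forallP std_m; apply/forallP => j.
exact: leq_ltn_trans (le_m j) (std_m j).
Qed.

Lemma std_monB m j : std m -> std (m - U_(j))%MM.
Proof. by apply: std_mon_le => l; rewrite mnmBE leq_subr. Qed.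

(** Divisors of standard monomials are standard, so the discarded monomials span an ideal and may be
    dropped before or after multiplying. *)
Lemma mci_mul_red c f : mci_mul d (lin_form c) (red f) = red (lin_form c * f).
Proof.
apply/mpolyP => m; rewrite !mcoeff_mci_red; case: ifP => // std_m.
rewrite !mcoeff_lin_form_mul; apply: eq_bigr => j _.
by rewrite mcoeff_mci_red std_monB.
Qed.

Lemma iter_mci_mul c q f : red f = f ->
  iter q (mci_mul d (lin_form c)) f = red (lin_form c ^+ q * f).
Proof.
move=> red_f; elim: q => [|q IHq] /=; first by rewrite mul1r.
by rewrite IHq mci_mul_red mulrA -exprS.
Qed.

(** If no variable could be added, every exponent would be at least d_j - 1 and the degree at least
    t. This is why the socle of A sits in degree t. *)
Lemma std_monS m : (forall j, 0 < d j)%N -> std m -> (mdeg m < t)%N ->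
  exists j, std (m + U_(j))%MM.
Proof.
move=> d_gt0 std_m; rewrite ltnNge => /negP lt_mt.
case: (boolP [forall j, (d j - 1 <= m j)%N]) => [/forallP ge_m|].
  by case: lt_mt; rewrite mdegE; apply: leq_sum.
case/forallPn=> j; rewrite -ltnNge => lt_mj; exists j; apply/forallP => l.
rewrite mnmDE mnm1E; case: eqP => [<-|_].
  by rewrite addn1; move: lt_mj (d_gt0 j); case: (d j) => // a; rewrite subn1.
by rewrite addn0 (forallP std_m).
Qed.

Lemma std_mon_exists q : (forall j, 0 < d j)%N -> (q <= t)%N ->
  exists2 m, std m & mdeg m = q.
Proof.
move=> d_gt0; elim: q => [|q IHq] le_qt.
  by exists 0%MM; rewrite ?mdeg0 //; apply/forallP => j; rewrite mnm0E.
have [m std_m deg_m] := IHq (ltnW le_qt).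
have [|j std_mj] := std_monS d_gt0 std_m; first by rewrite deg_m.
by exists (m + U_(j))%MM; rewrite // mdegD mdeg1 deg_m addn1.
Qed.

(** The multinomial formula with denominators cleared, so that it holds in any characteristic.
    Taking one x_j off x^m contributes m_j q!, and the m_j sum to q + 1. *)
Lemma mcoeff_sum_vars_exp q m : mdeg m = q ->
  (lin_form (fun _ : 'I_n => 1 : k) ^+ q)@_m * (\prod_j (m j)`!)%:R = q`!%:R.
Proof.
elim: q m => [|q IHq] m deg_m.
  move/eqP: deg_m; rewrite mdeg_eq0 => /eqP->; rewrite expr0 mcoeff1 eqxx mul1r.
  by rewrite big1 // => j _; rewrite mnm0E.
rewrite exprS mcoeff_lin_form_mul mulr_suml.
transitivity (\sum_(j | (0 < m j)%N) (m j)%:R * (q`!)%:R : k).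
  apply: eq_bigr => j mj_gt0; rewrite mul1r.
  have deg_mj: mdeg (m - U_(j))%MM = q.
    by apply/eqP; rewrite -(eqn_add2r 1) -(mdeg1 j) -mdegD submK
         ?lep1mP -?lt0n // mdeg1 deg_m addn1.
  rewrite -(IHq _ deg_mj) mulrCA; congr (_ * _); rewrite -natrM; congr _%:R.
  rewrite (bigD1 j) //= [in RHS](bigD1 j) //= mulnA; congr (_ * _)%N.
    by rewrite mnmBE mnm1E eqxx subn1; case: (m j) mj_gt0.
  by apply: eq_bigr => l ne_lj; rewrite mnmBE mnm1E eq_sym (negPf ne_lj) subn0.
rewrite -mulr_suml factS natrM; congr (_ * _).
rewrite -natr_sum -deg_m mdegE; congr _%:R.
by rewrite big_mkcond; apply: eq_bigr => j _; case: (m j).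
Qed.

(** * The lowering operator and its commutator with multiplication *)

(* The lowering operator of the sl2-action on A, lifted to polynomials so
   that the Leibniz rule applies: x_j^a goes to a (d_j - a) x_j^(a-1). *)
Definition lowering f : {mpoly k[n]} :=
  \sum_(j < n) (((d j)%:R - 1) *: f^`M(j) - 'X_j * f^`M(j)^`M(j)).

Lemma mcoeff_lowering f m :
  (lowering f)@_m =
  \sum_(j < n) (m j).+1%:R * ((d j)%:R - (m j).+1%:R) * f@_(m + U_(j)).
Proof.
rewrite /lowering raddf_sum; apply: eq_bigr => j _ /=.
rewrite mcoeffB mcoeffZ mcoeff_mulX !mcoeff_deriv.
case: ifP => [mj_gt0|]; last first.
  by case: (m j) => // _; rewrite subr0 mul1r mulr1n.
rewrite submK ?lep1mP -?lt0n // mnmBE mnm1E eqxx.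
case: (m j) mj_gt0 => // a _; rewrite subn1 /=.
rewrite -[_ *+ a.+2]mulr_natl -[_ *+ a.+1]mulr_natl -[a.+2%:R]natr1 -[a.+1%:R]natr1.
ring.
Qed.

Lemma loweringZ a f : lowering (a *: f) = a *: lowering f.
Proof.
apply/mpolyP => m; rewrite mcoeffZ !mcoeff_lowering mulr_sumr.
by apply: eq_bigr => j _; rewrite mcoeffZ mulrCA.
Qed.

Lemma lowering0 : lowering 0 = 0.
Proof. by rewrite -(scale0r 0) loweringZ !scale0r. Qed.

(* The factor d_j - a vanishes exactly when lowering crosses the boundary
   between non-standard and standard monomials. *)
Lemma lowering_red f : lowering (red f) = red (lowering f).
Proof.
apply/mpolyP => m; rewrite mcoeff_mci_red !mcoeff_lowering.
case: ifP => [std_m|nstd_m].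
  apply: eq_bigr => j _; rewrite mcoeff_mci_red; case: ifP => // /negP nstd_mj.
  suff ->: (m j).+1 = d j by rewrite subrr !(mulr0, mul0r).
  apply/eqP; rewrite eqn_leq (forallP std_m j) leqNgt; apply/negP => lt_mj.
  case: nstd_mj; apply/forallP => l; rewrite mnmDE mnm1E.
  by case: eqP => [<-|_]; rewrite ?addn1 // addn0 (forallP std_m).
rewrite big1 // => j _; rewrite mcoeff_mci_red; case: ifP => [|_]; rewrite ?mulr0 //.
move=> std_mj; rewrite (@std_mon_le (m + U_(j))%MM) // in nstd_m.
by move=> l; rewrite mnmDE leq_addr.
Qed.

Lemma lowering_piece i f : piece i.+1 f -> piece i (lowering f).
Proof.
move=> pf; rewrite -(mci_red_piece pf) lowering_red.
move: pf => /mci_pieceP f0; apply/mci_pieceP => m.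
rewrite mcoeff_mci_red; case: ifP => //= _ deg_m.
rewrite mcoeff_lowering big1 // => j _; rewrite f0 ?mulr0 //.
by rewrite mdegD mdeg1 addn1 eqSS (negPf deg_m) andbF.
Qed.

Lemma iter_lowering_piece i j f :
  (j <= i)%N -> piece i f -> piece (i - j) (iter j lowering f).
Proof.
move=> le_ji pf; elim: j le_ji => [|j IHj] le_ji; first by rewrite subn0.
by apply: lowering_piece; rewrite -subSn // subSS; apply: IHj; apply: ltnW.
Qed.

Lemma euler_piece i f : piece i f -> \sum_(j < n) 'X_j * f^`M(j) = i%:R *: f.
Proof.
move=> /mci_pieceP f0; apply/mpolyP => m; rewrite raddf_sum mcoeffZ /=.
transitivity (\sum_(j < n) (m j)%:R * f@_m).
  apply: eq_bigr => j _; rewrite mcoeff_mulX mcoeff_deriv.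
  case: ifP => [mj_gt0|]; last by case: (m j); rewrite // mul0r.
  rewrite submK ?lep1mP -?lt0n // mnmBE mnm1E eqxx subn1 prednK //.
  by rewrite mulr_natl.
rewrite -mulr_suml -natr_sum -mdegE; case: (eqVneq (mdeg m) i) => [->//|ne].
by rewrite f0 ?mulr0 // (negPf ne) andbF.
Qed.

(** The terms of the operator in the other variables commute with x_l; the term j = l is computed by
    the Leibniz rule. *)
Lemma lowering_mulX l f :
  lowering ('X_l * f) - 'X_l * lowering f =
  ((d l)%:R - 1) *: f - ('X_l * f^`M(l)) *+ 2.
Proof.
have dX j : ('X_l : {mpoly k[n]})^`M(j) = (l == j)%:R.
  rewrite mderivX mnm1E; case: eqP => [->|_]; last by rewrite scale0r.
  suff ->: (U_(j) - U_(j))%MM = 0%MM :> 'X_{1..n} by rewrite scale1r mpolyX0.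
  by apply/mnmP => i; rewrite mnmBE subnn mnm0E.
rewrite /lowering mulr_sumr -sumrB (bigD1 l) //= big1 ?addr0 => [|j ne_jl].
  have d1: (1 : {mpoly k[n]})^`M(l) = 0 by rewrite -mpolyC1 mderivC.
  rewrite !(mderivM, mderivD) dX eqxx mulr1n d1 -!mul_mpolyC.
  by set a := _%:MP_[n]; ring.
rewrite !(mderivM, mderivD) dX eq_sym (negPf ne_jl) mulr0n mderiv0 -!mul_mpolyC.
by set a := _%:MP_[n]; ring.
Qed.

(** The one-variable commutators are summed over l: the constants d_l - 1 add up to t, and Euler's
    identity turns the derivative terms into 2i. *)
Lemma lowering_sl2 i f : (forall j, 0 < d j)%N -> piece i f ->
  let E := mci_mul d (lin_form (fun=> 1)) in
  lowering (E f) - E (lowering f) = (t%:R - 2 * i%:R) *: f.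
Proof.
move=> d_gt0 pf /=; rewrite /mci_mul lowering_red -mci_redB.
rewrite -[RHS](mci_red_piece (i := i)); last first.
  apply/mci_pieceP => m /(proj1 (mci_pieceP _ _) pf) fm0.
  by rewrite mcoeffZ fm0 mulr0.
congr red; rewrite /lin_form.
have loweringS (F : 'I_n -> {mpoly k[n]}) :
    lowering (\sum_l F l) = \sum_l lowering (F l).
  apply/mpolyP => m; rewrite [RHS]raddf_sum mcoeff_lowering /=.
  under [RHS]eq_bigr do rewrite mcoeff_lowering.
  by rewrite exchange_big; apply: eq_bigr => j _; rewrite raddf_sum mulr_sumr.
rewrite !mulr_suml loweringS -sumrB.
under eq_bigr => l _ do rewrite scale1r lowering_mulX.
rewrite sumrB -scaler_suml sumrMnl (euler_piece pf) scalerBl.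
congr (_ *: _ - _); last by rewrite scalerMnl mulr_natl.
by rewrite natr_sum; apply: eq_bigr => l _; rewrite natrB.
Qed.


Lemma mci_mulZ c a f :
  mci_mul d (lin_form c) (a *: f) = a *: mci_mul d (lin_form c) f.
Proof. by rewrite /mci_mul -scalerAr mci_redZ. Qed.

Lemma mci_mul0 c : mci_mul d (lin_form c) 0 = 0.
Proof. by rewrite -(scale0r 0) mci_mulZ !scale0r. Qed.

(** Moving E past one F at F^l v costs the weight t - 2(i - l). For l from 0 to j these add up to
    (j+1)(t - 2i + j), and the remaining term F^(j+1) E v vanishes. *)
Lemma mul_iter_lowering i j v :
  (forall l, 0 < d l)%N -> (i.*2 <= t)%N -> piece i v ->
  mci_mul d (lin_form (fun=> 1)) v = 0 -> (j <= i)%N ->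
  mci_mul d (lin_form (fun=> 1)) (iter j.+1 lowering v) =
  - (j.+1 * (t - i.*2 + j))%:R *: iter j lowering v.
Proof.
move=> d_gt0 le_it pv Ev0.
have step l : (l <= i)%N ->
    mci_mul d (lin_form (fun=> 1)) (iter l.+1 lowering v) =
    lowering (mci_mul d (lin_form (fun=> 1)) (iter l lowering v))
    - (t%:R - 2 * (i - l)%:R) *: iter l lowering v.
  move=> le_li; rewrite -(lowering_sl2 d_gt0 (iter_lowering_piece le_li pv)).
  by rewrite opprB addrC subrK.
elim: j => [|j IHj] le_ji; rewrite step //.
  rewrite /= Ev0 lowering0 sub0r -scaleNr subn0 mul1n addn0 natrB // -mul2n.
  by rewrite natrM.
rewrite IHj ?(ltnW le_ji) // loweringZ -scalerBl; congr (_ *: _).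
rewrite natrB // !natrM !natrD natrB // -mul2n natrM -!natr1; ring.
Qed.

(** * Injectivity below the middle degree for the sum of the variables *)

Lemma fact_neq0_pchar p q : p \in [pchar k] -> (q < p)%N -> (q`!%:R : k) != 0.
Proof.
move=> pk; rewrite -(dvdn_pcharf pk); elim: q => [|q IHq] lt_qp.
  by rewrite gtnNdvd // prime_gt1 // (pcharf_prime pk).
rewrite factS Euclid_dvdM ?(pcharf_prime pk) // negb_or IHq ?(ltnW lt_qp) //.
by rewrite gtnNdvd.
Qed.

Lemma mul_inj_middle p i : p \in [pchar k] -> (forall l, 0 < d l)%N ->
  (i.*2 < t <= i.*2.+2)%N -> (i.+1 < p)%N ->
  mul_inj d (lin_form (fun _ : 'I_n => 1 : k)) i.
Proof.
move=> pk d_gt0 /andP[lt_it le_ti] lt_ip v pv Ev0.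
pose E := mci_mul d (lin_form (fun _ : 'I_n => 1 : k)).
have EF j : (j <= i)%N -> E (iter j.+1 lowering v) =
    - (j.+1 * (t - i.*2 + j))%:R *: iter j lowering v.
  exact: mul_iter_lowering (ltnW lt_it) pv Ev0.
have iterEZ q a f : iter q E (a *: f) = a *: iter q E f.
  by elim: q => //= q ->; rewrite /E mci_mulZ.
(* By [EF], each E sends F^j v to a multiple of F^(j-1) v, so j + 1 applications end at E v = 0. *)
have EF0 j : (j <= i)%N -> iter j.+1 E (iter j lowering v) = 0.
  elim: j => [|j IHj] le_ji; first exact: Ev0.
  by rewrite iterSr EF ?(ltnW le_ji) // iterEZ IHj ?scaler0 // ltnW.
have F0 j : (j <= i)%N -> iter j lowering v = 0 -> v = 0.
  elim: j => [|j IHj] le_ji //= Fj0; apply: IHj (ltnW le_ji) _.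
  have := EF j (ltnW le_ji); rewrite [iter j.+1 _ _]Fj0 /E mci_mul0.
  move/eqP; rewrite eq_sym scaler_eq0 oppr_eq0 => /orP[|/eqP//].
  (* Here j + 1 <= i, and t <= 2i + 2 gives t - 2i + j <= i + 1; both factors lie strictly between 0
     and p. *)
  rewrite -(dvdn_pcharf pk) Euclid_dvdM ?(pcharf_prime pk) // !gtnNdvd //.
  - by rewrite addn_gt0 subn_gt0 lt_it.
  - by lia.
  - by rewrite (leq_ltn_trans le_ji) // ltnW.
apply: (F0 i) => //.
have := iter_lowering_piece (leqnn i) pv; rewrite subnn => /mci_pieceP pF.
set w := iter i lowering v in pF *.
have w_const : w = w@_0 *: 1.
  apply/mpolyP => m; rewrite mcoeffZ mcoeff1 -mdeg_eq0.
  case: (eqVneq (mdeg m) 0) => [/eqP|m_neq0].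
    by rewrite mdeg_eq0 => /eqP->; rewrite mulr1.
  by rewrite pF ?mulr0 // negb_and m_neq0 orbT.
(* Any standard monomial of degree i + 1 detects the scalar [w]: its coefficient in l^(i+1), times a
   product of factorials, is (i+1)!, which is nonzero in [k]. *)
have [|m std_m deg_m] := @std_mon_exists i.+1 d_gt0.
  by rewrite (leq_ltn_trans _ lt_it) // -addnn leq_addr.
have := congr1 (mcoeff m) (EF0 i (leqnn i)); rewrite -/w.
rewrite iter_mci_mul; last exact/(mci_red_piece (i := 0))/mci_pieceP.
rewrite mcoeff_mci_red std_m w_const -scalerAr mulr1 mcoeffZ mcoeff0.
move/(congr1 ( *%R^~ (\prod_j (m j)`!)%:R)); rewrite mul0r -mulrA mcoeff_sum_vars_exp //.
move/eqP; rewrite mulf_eq0 (negPf (fact_neq0_pchar pk lt_ip)) orbF => /eqP->.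
by rewrite scale0r.
Qed.

(** Below the socle degree some x_j carries the monomial x^m to a standard one, so the coefficient
    of f at m survives in x_j f, which lies in degree i + 1 and is still killed by l. *)
Lemma mul_inj_pred i : (forall l, 0 < d l)%N -> (i < t)%N ->
  mul_inj d (lin_form (fun _ : 'I_n => 1 : k)) i.+1 ->
  mul_inj d (lin_form (fun _ : 'I_n => 1 : k)) i.
Proof.
move=> d_gt0 lt_it inj f pf Ef0; apply/mpolyP => m; rewrite mcoeff0.
have := proj1 (mci_pieceP i f) pf m.
case: (boolP (std m && (mdeg m == i))) => [/andP[std_m /eqP deg_m] _|_ ->//].
rewrite -deg_m in lt_it; have [j std_mj] := std_monS d_gt0 std_m lt_it.
suff: (red ('X_j * f))@_(m + U_(j)) = 0.
  rewrite mcoeff_mci_red std_mj mcoeff_mulX mnmDE mnm1E eqxx addn1 /=.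
  by rewrite addmK.
suff ->: red ('X_j * f) = 0 by rewrite mcoeff0.
apply: inj.
  apply/mci_pieceP => m'; rewrite mcoeff_mci_red; case: ifP => //= _ deg_m'.
  rewrite mcoeff_mulX; case: ifP => // m'j_gt0.
  apply: (proj1 (mci_pieceP i f) pf); apply: contraNN deg_m' => /andP[_ /eqP deg].
  have le_jm': (U_(j) <= m')%MM by rewrite lep1mP -lt0n.
  by rewrite -(submK le_jm') mdegD mdeg1 deg addn1.
transitivity (red ('X_j * mci_mul d (lin_form (fun=> 1)) f)); last first.
  by rewrite Ef0 mulr0 -(scale0r 0) mci_redZ !scale0r.
(* Viewing x_j as a linear form lets [mci_mul_red] apply to both factors, which then commute. *)
have -> : 'X_j = lin_form (fun l => (l == j)%:R : k).
  rewrite /lin_form (bigD1 j) //= eqxx scale1r big1 ?addr0 // => l ne_lj.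
  by rewrite (negPf ne_lj) scale0r.
by rewrite mci_mul_red -[RHS]/(mci_mul d _ _) mci_mul_red mulrCA.
Qed.

(** Induction on t - 2i raises i until t <= 2i + 2; there 2i + 2 <= t + 1 < 2p gives i + 1 < p. *)
Lemma mul_inj_half p i : p \in [pchar k] -> (forall l, 0 < d l)%N ->
  (t.+1 < p.*2)%N -> (i.*2 < t)%N ->
  mul_inj d (lin_form (fun _ : 'I_n => 1 : k)) i.
Proof.
move=> pk d_gt0 lt_tp.
have [e] := ubnP (t - i.*2); elim: e i => // e IHe i lt_e lt_it.
case: (leqP t i.*2.+2) => [le_ti|lt_it2].
  apply: (mul_inj_middle pk) => //; first by rewrite lt_it.
  rewrite -ltn_double doubleS; exact: leq_ltn_trans lt_tp.
apply: mul_inj_pred => //.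
  by apply: leq_ltn_trans lt_it; rewrite -addnn leq_addr.
apply: IHe; rewrite doubleS //.
rewrite -ltnS (leq_ltn_trans _ lt_e) // ltn_sub2l // ltnW //.
Qed.

(** * Surjectivity from injectivity by monomial duality *)

Lemma mcoeff_lin_form_mul_sum c (T : finType) (P : pred T)
    (h : T -> k) (phi : T -> 'X_{1..n}) m :
  (lin_form c * \sum_(x | P x) h x *: 'X_[phi x])@_m =
  \sum_(x | P x) h x * \sum_j c j * (phi x + U_(j) == m)%MM%:R.
Proof.
rewrite mulr_sumr raddf_sum; apply: eq_bigr => x _ /=.
rewrite -scalerAr mcoeffZ /lin_form mulr_suml raddf_sum; congr (_ * _).
apply: eq_bigr => j _ /=.
by rewrite -scalerAl -mpolyXD mcoeffZ mcoeffX addmC.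
Qed.

(* x^m goes to x^(d-1-m), which turns the transpose of multiplication by a
   linear form back into multiplication by it. *)
Definition compl_mon m : 'X_{1..n} := [multinom (d j - 1 - m j)%N | j < n].

Lemma compl_monK m : std m -> compl_mon (compl_mon m) = m.
Proof. by move=> /forallP std_m; apply/mnmP => j; rewrite !mnmE; have := std_m j; lia. Qed.

Lemma std_compl_mon m : (forall j, 0 < d j)%N -> std (compl_mon m).
Proof. by move=> d_gt0; apply/forallP => j; rewrite mnmE; have := d_gt0 j; lia. Qed.

Lemma mdeg_compl_mon m : std m -> (mdeg (compl_mon m) + mdeg m = t)%N.
Proof.
move=> /forallP std_m; rewrite !mdegE -big_split; apply: eq_bigr => j _ /=.
by rewrite mnmE; have := std_m j; lia.
Qed.

(** Complements reverse divisibility, so the nonzero matrix entries of x_j are transposed. *)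
Lemma compl_monD m m' j : std m -> std m' ->
  ((compl_mon m' + U_(j))%MM == compl_mon m) = ((m + U_(j))%MM == m').
Proof.
move=> /forallP std_m /forallP std_m'; apply/eqP/eqP => /mnmP eq_m; apply/mnmP => l.
  by have := eq_m l; rewrite !mnmE; have := std_m l; have := std_m' l; lia.
by have := eq_m l; rewrite !mnmE; have := std_m l; have := std_m' l; lia.
Qed.

Lemma mul_surj_of_inj c i : (forall j, 0 < d j)%N -> (i < t)%N ->
  mul_inj d (lin_form c) (t - i.+1) -> mul_surj d (lin_form c) i.
Proof.
move=> d_gt0 lt_it inj g pg.
(* Standard monomials have degree at most t, so this finite type contains them all. *)
pose T := 'X_{1..n < t.+1}.
pose P (x : T) := std x && (mdeg x == t - i.+1)%N.
pose Q (y : T) := std y && (mdeg y == t - i)%N.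
pose a (x y : T) : k := \sum_j c j * ((x + U_(j))%MM == y :> 'X_{1..n})%:R.
have mdeg_lt m : std m -> (mdeg m < t.+1)%N.
  by move=> /mdeg_compl_mon <-; rewrite ltnS leq_addl.
have [|h hP] := transpose_surj (P := P) (Q := Q) (a := a) _ (fun x => g@_(compl_mon x)).
  move=> f f0 x Px.
  pose F := \sum_(x : T | P x) f x *: 'X_[x].
  have coefF (y : T) : F@_y = if P y then f y else 0.
    rewrite /F raddf_sum big_mkcond (bigD1 y) //= big1 => [|z ne_zy].
      by rewrite mcoeffZ mcoeffX eqxx mulr1 addr0.
    rewrite mcoeffZ mcoeffX; case: ifP => // _.
    by rewrite (inj_eq val_inj) (negPf ne_zy) mulr0.
  suff F0 : F = 0 by have := coefF x; rewrite Px F0 mcoeff0.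
  apply: inj.
    apply/mci_pieceP => m nPm; rewrite /F raddf_sum big1 // => z Pz /=.
    rewrite mcoeffZ mcoeffX; case: eqP => [eq_m|]; rewrite ?mulr0 //.
    by move: Pz nPm; rewrite /P eq_m => ->.
  apply/mpolyP => m; rewrite mcoeff_mci_red mcoeff0; case: ifP => // std_m.
  rewrite mcoeff_lin_form_mul_sum; case: (eqVneq (mdeg m) (t - i)%N) => [deg_m|ne].
    by apply: (f0 (BMultinom (mdeg_lt _ std_m))); rewrite /Q /= std_m deg_m eqxx.
  rewrite big1 // => z /andP[_ /eqP deg_z]; rewrite big1 ?mulr0 // => j _.
  case: eqP => [eq_m|]; rewrite ?mulr0 //.
  by move: ne; rewrite -eq_m mdegD mdeg1 deg_z addn1 -subSn // subSS eqxx.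
(* The solution [h] is indexed by degree t - i; complementing its monomials moves it to degree i. *)
exists (\sum_(y : T | Q y) h y *: 'X_[compl_mon y]).
  apply/mci_pieceP => m nm; rewrite raddf_sum big1 // => y /andP[std_y /eqP deg_y] /=.
  rewrite mcoeffZ mcoeffX; case: eqP => [eq_m|]; rewrite ?mulr0 //.
  move: nm; rewrite -eq_m std_compl_mon // -(eqn_add2r (mdeg y)) mdeg_compl_mon //.
  by rewrite deg_y subnKC ?eqxx // ltnW.
apply/mpolyP => m; rewrite mcoeff_mci_red.
case: ifP => [std_m|nstd_m]; last by rewrite (proj1 (mci_pieceP _ _) pg) // nstd_m.
rewrite mcoeff_lin_form_mul_sum.
have std_cm := std_compl_mon m d_gt0.
have := mdeg_compl_mon std_m.
case: (eqVneq (mdeg m) i.+1) => [deg_m|ne] deg_cm.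
  have Pcm : P (BMultinom (mdeg_lt _ std_cm)).
    by rewrite /P /= std_cm -deg_cm deg_m addnK eqxx.
  have := hP _ Pcm; rewrite /= compl_monK // => <-.
  apply: eq_bigr => y /andP[std_y _]; rewrite mulrC; congr (_ * _).
  apply: eq_bigr => j _; congr (_ * _%:R).
  by rewrite -{1}(compl_monK std_m) compl_monD.
rewrite (proj1 (mci_pieceP _ _) pg) ?std_m ?(negPf ne) // big1 // => y /andP[std_y /eqP deg_y].
rewrite big1 ?mulr0 // => j _; case: eqP => [eq_m|]; rewrite ?mulr0 //.
have := mdeg_compl_mon std_y; move: ne; rewrite -eq_m mdegD mdeg1; lia.
Qed.

Lemma mul_surj_top c i : (t <= i)%N -> mul_surj d (lin_form c) i.
Proof.
move=> le_ti g pg; exists 0 => [m|]; first by rewrite msupp0.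
rewrite mci_mul0; apply/mpolyP => m; rewrite mcoeff0.
rewrite (proj1 (mci_pieceP _ _) pg) //; apply/negP => /andP[/mdeg_compl_mon]; lia.
Qed.

(** * From injectivity below the middle to the weak Lefschetz property *)

Lemma WLP_of_inj_half c : (forall j, 0 < d j)%N ->
  (forall i, (i.*2 < t)%N -> mul_inj d (lin_form c) i) -> mci_WLP k d.
Proof.
move=> d_gt0 inj; exists c => i.
case: (ltnP i.*2 t) => [lt_it|le_ti]; first by left; apply: inj.
right; case: (ltnP i t) => [lt_it|]; last exact: mul_surj_top.
(* From t <= 2i follows 2(t - 1 - i) <= t - 2, so the dual degree lies below t/2. *)
by apply: mul_surj_of_inj => //; apply: inj; lia.
Qed.

(** In degree i the exponent of x_l is at most i < d_l - 1, so x_l maps distinct standard monomials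
    to distinct standard monomials. *)
Lemma mul_inj_var l i : (i.+1 < d l)%N ->
  mul_inj d (lin_form (fun j => (j == l)%:R : k)) i.
Proof.
move=> lt_il f /mci_pieceP f0 Ef0; apply/mpolyP => m; rewrite mcoeff0.
case: (boolP (std m && (mdeg m == i))) => [/andP[std_m /eqP deg_m]|/f0//].
have std_ml : std (m + U_(l))%MM.
  apply/forallP => j; rewrite mnmDE mnm1E; case: eqP => [<-|_].
    by apply: leq_ltn_trans lt_il; rewrite addn1 ltnS -deg_m mdegE (bigD1 l) //= leq_addr.
  by rewrite addn0 (forallP std_m).
have := congr1 (mcoeff (m + U_(l))%MM) Ef0.
rewrite mcoeff_mci_red std_ml mcoeff_lin_form_mul mcoeff0 (bigD1 l) /=; last first.
  by rewrite mnmDE mnm1E eqxx addn1.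
rewrite eqxx mul1r addmK big1 ?addr0 // => j /andP[_ ne_jl].
by rewrite (negPf ne_jl) mul0r.
Qed.

End MonomialCompleteIntersection.

Theorem theorem4p4 (k : fieldType) (p n : nat) (d : 'I_n -> nat) :
  (p \in [pchar k])%R ->
  (forall i, 0 < d i)%N ->
  (\sum_(i < n) (d i - 1) + 1 < 2 * maxn p (\max_(i < n) d i))%N ->
  mci_WLP k d.
Proof.
move=> pk d_gt0; rewrite mul2n addn1 => lt_t.
case: (leqP p (\max_(i < n) d i)) lt_t => [_|_] lt_t.
  have [l lt_tl] : exists l, (\sum_(i < n) (d i - 1)).+1 < (d l).*2.
    apply/existsP; apply: contraLR lt_t => /existsPn le_d; rewrite -leqNgt.
    rewrite -geq_half_double; apply/bigmax_leqP => l _.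
    by rewrite geq_half_double leqNgt.
  (* For 2i < t one has 2i + 2 <= t + 1 < 2 d_l, hence i + 1 < d_l. *)
  apply: (WLP_of_inj_half d_gt0) => i lt_it; apply: (mul_inj_var (l := l)); lia.
by apply: (WLP_of_inj_half d_gt0) => i; apply: mul_inj_half pk d_gt0 lt_t.
Qed.
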